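(* Let $n\ge 6$ and let $k$ be an integer with $2\le k\le n-3$. Let $H$ be the bent linear 2-tree on $n$ vertices with a single bend at vertex $k$ (defined in the context), with every edge having resistance $1$. Let $m=n-2$ and $\ell=m-k+1$. Then the effective resistance between vertices $1$ and $n$ is \[ r_{m,k}(1,n)=\frac{(F_{2\ell+2}F_{k-1}^2+F_{2k-2}F^2_{\ell})(F_{2\ell+2}F^2_{k-2}+F_{2k-2}F^2_{\ell+1}+F_{2k-2}F_{2\ell+2})}{F_{2k-2}F_{2\ell+2}F_{2m+2}}+\sum_{i=1}^{k-2}\frac{F_iF_{i+1}}{L_iL_{i+1}}+\sum_{i=1}^{\ell}\frac{F_iF_{i+1}}{L_iL_{i+1}}, \] where $F_p$ denotes the $p$th Fibonacci number and $L_q$ the $q$th Lucas number.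
   Context: Fibonacci numbers: $F_0=0$, $F_1=1$, $F_{p+1}=F_p+F_{p-1}$. Lucas numbers: $L_0=2$, $L_1=1$, $L_{q+1}=L_q+L_{q-1}$. The straight linear 2-tree $G_n$ is the graph with vertex set $\{1,\dots,n\}$ in which $\{i,j\}$ is an edge iff $0<|i-j|\le 2$. The bent linear 2-tree $H_n$ with bend at vertex $k$ (where $1\le k\le n-3$) has vertex set $\{1,\dots,n\}$ and edge set $(E(G_n)\cup\{\{k,k+3\}\})\setminus\{\{k+1,k+3\}\}$. The graph is viewed as an electrical network where each edge is a unit resistor (edge weight 1); the effective resistance (resistance distance) between vertices $i,j$ is $r(i,j)=(e_i-e_j)^T L^\dagger (e_i-e_j)$, where $L$ is the graph Laplacian and $L^\dagger$ its Moore–Penrose pseudoinverse. $r_{m,k}(1,n)$ denotes this resistance between vertices $1$ and $n$ in $H_n$, with $m=n-2$ the number of triangles. *)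

(* Defs.v *)
From HB Require Import structures.
From mathcomp Require Import all_boot all_order all_algebra.

Set Implicit Arguments.
Unset Strict Implicit.
Unset Printing Implicit Defensive.

Import Order.TTheory GRing.Theory Num.Theory.

Local Open Scope nat_scope.

Fixpoint fib (n : nat) : nat :=
  match n with
  | 0 => 0
  | 1 => 1
  | (p.+1 as q).+1 => fib q + fib p
  end.

Fixpoint lucas (n : nat) : nat :=
  match n with
  | 0 => 2
  | 1 => 1
  | (p.+1 as q).+1 => lucas q + lucas p
  end.

(* Vertices are numbered from 1 to n. *)
Definition vlabel (n : nat) (i : 'I_n) : nat := i.+1.

Definition same_pair (a b i j : nat) : bool :=
  (i == a) && (j == b) || (i == b) && (j == a).

Definition straight_edge (n : nat) : rel 'I_n :=
  fun i j => 0 < `|vlabel i - vlabel j| <= 2.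

Definition bent_edge (n k : nat) : rel 'I_n :=
  fun i j => (straight_edge i j || same_pair k (k + 3) (vlabel i) (vlabel j))
             && ~~ same_pair (k + 1) (k + 3) (vlabel i) (vlabel j).

Lemma bent_edge_sym n k : symmetric (@bent_edge n k).
Proof.
have pairC a b i j : same_pair a b i j = same_pair a b j i.
  by rewrite /same_pair orbC andbC [(i == a) && _]andbC.
by move=> i j; rewrite /bent_edge /straight_edge distnC !(pairC _ _ (vlabel i)).
Qed.

Lemma bent_edge_irr n k : irreflexive (@bent_edge n k).
Proof.
move=> i; apply/negP; rewrite /bent_edge /straight_edge distnn /same_pair /=.
case/andP=> /orP[]/andP[/eqP -> ] + _; last by rewrite -[X in _ == X]addn0 eqn_add2l.
by rewrite -[X in X == _]addn0 eqn_add2l.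
Qed.

Local Open Scope ring_scope.

Definition laplacian (R : nzRingType) (n : nat) (e : rel 'I_n) : 'M[R]_n :=
  \matrix_(i, j) (if i == j then #|[set h | e i h]|%:R else - (e i j)%:R).

Record moore_penrose (R : nzRingType) (m n : nat)
    (A : 'M[R]_(m, n)) (X : 'M[R]_(n, m)) : Prop := MoorePenrose {
  mp_mulK : A *m X *m A = A;
  mp_mulVK : X *m A *m X = X;
  mp_syml : (A *m X)^T = A *m X;
  mp_symr : (X *m A)^T = X *m A
}.

(* The rank factorization A = C *m B, with C of full column rank and B of full
   row rank, gives A^+ = B^T (B B^T)^-1 (C^T C)^-1 C^T; [mp_pinvP] and
   [moore_penrose_uniq] below identify it as the Moore-Penrose inverse. *)
Definition mp_pinv (R : realFieldType) (m n : nat) (A : 'M[R]_(m, n)) :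
    'M[R]_(n, m) :=
  let C := col_base A in let B := row_base A in
  B^T *m invmx (B *m B^T) *m invmx (C^T *m C) *m C^T.

Lemma row_free_gram_unit (R : realFieldType) (r n : nat) (B : 'M[R]_(r, n)) :
  row_free B -> B *m B^T \in unitmx.
Proof.
move=> Bfree; rewrite -row_free_unit; apply/inj_row_free => u.
rewrite mulmxA => uBB0.
suff uB0 : u *m B = 0 by apply: (row_free_inj Bfree); rewrite uB0 mul0mx.
have : (u *m B) *m (u *m B)^T = 0 by rewrite trmx_mul mulmxA uBB0 mul0mx.
move/matrixP/(_ 0 0); rewrite [LHS]mxE [RHS]mxE => /eqP.
rewrite psumr_eq0 => [/allP sq0|i _]; last by rewrite [_^T _ _]mxE sqr_ge0.
apply/rowP => i; have := sq0 i (mem_index_enum i).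
by rewrite /= [_^T _ _]mxE mulf_eq0 orbb => /eqP ->; rewrite mxE.
Qed.

Lemma mp_pinvP (R : realFieldType) (m n : nat) (A : 'M[R]_(m, n)) :
  moore_penrose A (mp_pinv A).
Proof.
have CBA := mulmx_base A.
rewrite /mp_pinv.
have BU := row_free_gram_unit (row_base_free A).
have CU : (col_base A)^T *m col_base A \in unitmx.
  rewrite -{2}[col_base A]trmxK; apply: row_free_gram_unit.
  by rewrite /row_free mxrank_tr; exact: col_base_full.
move: (\rank A) (col_base A) (row_base A) CBA BU CU => r C B CBA BU CU.
set X := _ *m C^T.
have BX : B *m X = invmx (C^T *m C) *m C^T.
  by rewrite /X !mulmxA mulmxV // mul1mx.
have XC : X *m C = B^T *m invmx (B *m B^T).
  by rewrite /X -!mulmxA mulVmx // mulmx1.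
have AX : A *m X = C *m invmx (C^T *m C) *m C^T by rewrite -CBA -!mulmxA BX.
have XA : X *m A = B^T *m invmx (B *m B^T) *m B by rewrite -CBA mulmxA XC.
split.
- by rewrite AX -CBA !mulmxA -[_ *m C^T *m C]mulmxA mulmxKV.
- by rewrite XA /X !mulmxA -[_ *m B *m B^T]mulmxA mulmxKV.
- by rewrite AX !trmx_mul trmxK trmx_inv trmx_mul trmxK mulmxA.
- by rewrite XA !trmx_mul trmxK trmx_inv trmx_mul trmxK mulmxA.
Qed.

Lemma moore_penrose_uniq (R : comNzRingType) (m n : nat) (A : 'M[R]_(m, n))
    (X Y : 'M[R]_(n, m)) :
  moore_penrose A X -> moore_penrose A Y -> X = Y.
Proof.
case=> AXA XAX AXs XAs [AYA YAY AYs YAs].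
have AXY : A *m X = A *m Y.
  by rewrite -AXs -{1}AYA -(mulmxA _ A) trmx_mul AXs AYs mulmxA AXA.
have XYA : X *m A = Y *m A.
  by rewrite -XAs -{1}AYA -mulmxA mulmxA trmx_mul XAs YAs -mulmxA (mulmxA A) AXA.
by rewrite -XAX -mulmxA AXY mulmxA XYA YAY.
Qed.

Definition resistance (R : realFieldType) (n : nat) (e : rel 'I_n)
    (i j : 'I_n) : R :=
  let d : 'cV[R]_n := delta_mx i 0 - delta_mx j 0 in
  (d^T *m mp_pinv (laplacian R e) *m d) 0 0.

(* Main.v *)
Require Import Defs.
From mathcomp Require Import all_boot all_order all_algebra.
From mathcomp Require Import zify ring lra.

Import Order.TTheory GRing.Theory Num.Theory.
Local Open Scope ring_scope.

(* A potential [p] with [L p = e_1 - e_n] gives [r(1,n) = p 1 - p n], so it is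
   enough to exhibit one.  Cutting the triangle (k, k+1, k+2), the graph is a
   union of two straight strips: one reads 1, ..., k, k+1, k+2, and the other,
   from the far end, reads n, ..., k+2, k, k+1, with k and k+1 exchanged.  On a
   straight strip traversed by a unit current from its end, the potential is
   explicit up to one free parameter, so matching both strips on the common
   triangle is a 2x2 linear system.  The sums in the formula telescope because
   [5 F_i F_(i+1) = L_i L_(i+1) - (F_(i+1) L_i - F_i L_(i+1))], and the rest is a
   rational identity in [F_(k-1)], [L_(k-1)], [F_(l+1)], [L_(l+1)] modulo
   [L_p^2 = 5 F_p^2 + 4 (-1)^p]. *)

(** * Resistance as a potential difference *)

Lemma laplacian_tr (R : nzRingType) (n : nat) (e : rel 'I_n) :
  symmetric e -> (laplacian R e)^T = laplacian R e.
Proof.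
move=> es; apply/matrixP => i j; rewrite !mxE eq_sym es.
by case: eqP => // ->.
Qed.

Lemma laplacian_mulE (R : nzRingType) (n : nat) (e : rel 'I_n) (p : 'cV[R]_n) i :
  irreflexive e ->
  (laplacian R e *m p) i 0 = \sum_h (e i h)%:R * (p i 0 - p h 0).
Proof.
move=> ei; rewrite mxE (bigD1 i) //= mxE eqxx [RHS](bigD1 i) //= ei mul0r add0r.
have -> : #|[set h | e i h]| = (\sum_(h | h != i) e i h)%N.
  rewrite -sum1_card big_mkcond [LHS](bigD1 i) //= inE ei add0n.
  by apply: eq_bigr => h _; rewrite inE; case: (e i h).
rewrite natr_sum mulr_suml -big_split; apply: eq_bigr => h hi /=.
by rewrite !mxE eq_sym (negPf hi) mulrBr mulNr.
Qed.

(** By symmetry of L the quadratic form becomes p^T L L^+ L p, which the first Penrose equation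
    collapses to p^T L p. *)
Lemma resistance_potential (R : realFieldType) (n : nat) (e : rel 'I_n)
    (i j : 'I_n) (p : 'cV[R]_n) :
  symmetric e -> laplacian R e *m p = delta_mx i 0 - delta_mx j 0 ->
  resistance R e i j = p i 0 - p j 0.
Proof.
move=> /(laplacian_tr R) Ls Lp; rewrite /resistance -Lp trmx_mul Ls.
have [LXL _ _ _] := mp_pinvP (laplacian R e).
have -> (X : 'M[R]_n) : p^T *m laplacian R e *m X *m (laplacian R e *m p)
    = p^T *m (laplacian R e *m X *m laplacian R e) *m p by rewrite !mulmxA.
rewrite LXL -mulmxA Lp mulmxBr.
have dotE (h : 'I_n) : (p^T *m delta_mx h 0 : 'M_1) 0 0 = p h 0.
  by rewrite -colE !mxE.
by rewrite -!dotE !mxE.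
Qed.

(** * Current balance at each vertex of the bent tree *)

Lemma sum_ord_indicator (R : nzRingType) (n a : nat) (f : nat -> R) :
  \sum_(h < n) (h == a :> nat)%:R * f h = (a < n)%N%:R * f a.
Proof.
case: (ltnP a n) => an.
  rewrite (bigD1 (Ordinal an)) //= eqxx big1 ?addr0 // => h.
  by rewrite -val_eqE /= => /negPf ->; rewrite mul0r.
rewrite mul0r big1 // => h _; case: eqP; rewrite ?mul0r // => ha.
by have := ltn_ord h; rewrite ha ltnNge an.
Qed.

(** Written as indicators in [h], adjacency can be summed term by term; the guards discard truncated
    predecessors. *)
Lemma straight_edgeE n (i h : 'I_n) :
  (straight_edge i h : nat) =
  ((h == i.+1 :> nat) + (h == i.+2 :> nat)
    + ((0 < i) && (h == i.-1 :> nat)) + ((1 < i) && (h == i.-2 :> nat)))%N.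
Proof.
rewrite /straight_edge /vlabel.
by case: i h => i ? [] h ? /=; lia.
Qed.

Lemma same_pairE a b i j : a != b ->
  (same_pair a b i j : nat) =
  (((i == a) && (j == b)) + ((i == b) && (j == a)))%N.
Proof. by rewrite /same_pair; lia. Qed.

(* Ordinals number the vertices from 0, so the bend is at index [K] for [k = K+1]. *)
Lemma bent_edgeE n K (i h : 'I_n) :
  (@bent_edge n K.+1 i h + same_pair K.+1 K.+3 i h
  = straight_edge i h + same_pair K K.+3 i h)%N.
Proof.
rewrite /bent_edge.
have [-> ->] : same_pair (K.+1 + 1) (K.+1 + 3) (vlabel i) (vlabel h)
    = same_pair K.+1 K.+3 i h /\
    same_pair K.+1 (K.+1 + 3) (vlabel i) (vlabel h) = same_pair K K.+3 i h.
  by rewrite /same_pair /vlabel !addSn addn1 addn3 !eqSS.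
(* The added edge is new and differs from the removed one, which is a straight edge; hence the
   Boolean operations become additive. *)
have : same_pair K K.+3 i h -> ~~ straight_edge i h && ~~ same_pair K.+1 K.+3 i h.
  rewrite /same_pair /straight_edge /vlabel; lia.
have : same_pair K.+1 K.+3 i h -> straight_edge i h.
  rewrite /same_pair /straight_edge /vlabel; lia.
by case: (same_pair K.+1); case: (same_pair K); case: (straight_edge i h); lia.
Qed.

(** The last four terms correct the straight tree for the added and the removed edge, each seen from
    both of its ends. *)
Lemma laplacian_bentE (R : nzRingType) (n K : nat) (p : nat -> R) (i : 'I_n) :
  (K.+3 < n)%N ->
  let D h : R := p i - p h in
  (laplacian R (@bent_edge n K.+1) *m (\col_h p h)) i 0 =
    (i.+1 < n)%:R * D i.+1 + (i.+2 < n)%:R * D i.+2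
    + (0 < i)%N%:R * D i.-1 + (1 < i)%N%:R * D i.-2
    + (i == K :> nat)%:R * D K.+3 + (i == K.+3 :> nat)%:R * D K
    - (i == K.+1 :> nat)%:R * D K.+3 - (i == K.+3 :> nat)%:R * D K.+1.
Proof.
move=> Kn D; rewrite laplacian_mulE; last exact: bent_edge_irr.
have eE (h : 'I_n) : (@bent_edge n K.+1 i h)%:R * D h =
    (h == i.+1 :> nat)%:R * D h + (h == i.+2 :> nat)%:R * D h
    + (0 < i)%N%:R * ((h == i.-1 :> nat)%:R * D h)
    + (1 < i)%N%:R * ((h == i.-2 :> nat)%:R * D h)
    + (i == K :> nat)%:R * ((h == K.+3 :> nat)%:R * D h)
    + (i == K.+3 :> nat)%:R * ((h == K :> nat)%:R * D h)
    - (i == K.+1 :> nat)%:R * ((h == K.+3 :> nat)%:R * D h)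
    - (i == K.+3 :> nat)%:R * ((h == K.+1 :> nat)%:R * D h).
  have /(congr1 (fun z => z%:R : R)) := bent_edgeE _ K i h.
  rewrite straight_edgeE !same_pairE; try lia.
  rewrite !natrD -!mulnb !natrM !addrA => eE.
  by rewrite !mulrA -!mulrDl -!mulrBl -eE [in RHS]addrAC !addrK.
under eq_bigr => h _ do rewrite !mxE eE.
rewrite !sumrB !big_split /= -!mulr_sumr !sum_ord_indicator.
have [K0 K1] : (K < n /\ K.+1 < n)%N by lia.
have [i1 i2] : (i.-1 < n /\ i.-2 < n)%N by have := ltn_ord i; lia.
by rewrite K0 K1 Kn i1 i2 !mul1r.
Qed.

(** * Fibonacci-Lucas identities and strip potentials *)

Section FibonacciLucas.
Variable R : realFieldType.
Local Notation F p := ((fib p)%:R : R).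
Local Notation L p := ((lucas p)%:R : R).

Lemma fib_lucasS p : F p.+1 = (F p + L p) / 2 /\ L p.+1 = (5 * F p + L p) / 2.
Proof.
have step q : F q.+2 = F q.+1 + F q /\ L q.+2 = L q.+1 + L q.
  by rewrite -!natrD.
elim: p => [|p [IF IL]]; first by rewrite /=; split; lra.
have [-> ->] := step p; rewrite IF IL; split; lra.
Qed.

Lemma fib_lucasD p q :
  F (p + q)%N = (F p * L q + L p * F q) / 2 /\
  L (p + q)%N = (5 * F p * F q + L p * L q) / 2.
Proof.
elim: p => [|p [IF IL]]; first by rewrite add0n /=; split; lra.
have [] := fib_lucasS (p + q); rewrite IF IL addSn => -> ->.
by have [-> ->] := fib_lucasS p; split; field.
Qed.

Lemma lucas_sqr p : L p ^+ 2 = 5 * F p ^+ 2 + 4 * (-1) ^+ p.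
Proof.
elim: p => [|p IH]; first by rewrite /=; lra.
have [-> ->] := fib_lucasS p; rewrite (exprS (-1)); lra.
Qed.

Lemma lucas_gt0 p : 0 < L p.
Proof.
rewrite ltr0n; suff : (0 < lucas p)%N && (0 < lucas p.+1)%N by case/andP.
elim: p => // p /andP[p0 p1]; rewrite p1.
by rewrite (_ : lucas p.+2 = lucas p.+1 + lucas p)%N // addn_gt0 p1.
Qed.

Lemma fib_gt0 p : (0 < p)%N -> 0 < F p.
Proof.
case: p => // p _; have [-> _] := fib_lucasS p.
by rewrite divr_gt0 // ltr_wpDl ?ler0n ?lucas_gt0.
Qed.

Lemma sum_fib_lucas p :
  \sum_(1 <= i < p.+1) F i * F i.+1 / (L i * L i.+1)
  = p%:R / 5 - (F p.+1 / L p.+1 - 1) / 5.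
Proof.
elim: p => [|p IH]; first by rewrite big_nil /=; field.
rewrite big_nat_recr //= IH.
have := (lt0r_neq0 (lucas_gt0 p.+1), lt0r_neq0 (lucas_gt0 p.+2)).
have [-> ->] := fib_lucasS p.+1.
rewrite -(@natr1 _ p); move: (L p.+1) (F p.+1) p%:R => y x t [y0 y1].
field; rewrite y0 andbT.
by apply: contra_neq y1 => ->; rewrite mul0r.
Qed.

(** Balance inside a straight strip has characteristic polynomial (x-1)^2 (x^2+3x+1). The second
    factor has roots -phi^2 and -phi^(-2), with phi the golden ratio, so these two sequences span
    its solutions. *)
Definition afib i : R := (-1) ^+ i * F (2 * i)%N.
Definition aluc i : R := (-1) ^+ i * L (2 * i)%N.

Lemma afib_alucS i :
  afib i.+1 = - (3 * afib i + aluc i) / 2 /\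
  aluc i.+1 = - (5 * afib i + 3 * aluc i) / 2.
Proof.
rewrite /afib /aluc exprS mulnS.
by have [-> ->] := fib_lucasD 2 (2 * i); rewrite /=; split; field.
Qed.

Lemma afib0 : afib 0 = 0. Proof. by rewrite /afib mulr0. Qed.
Lemma aluc0 : aluc 0 = 2. Proof. by rewrite /aluc mul1r. Qed.

Lemma afibE i : afib i = (-1) ^+ i * (F i * L i).
Proof. by rewrite /afib mul2n -addnn; have [-> _] := fib_lucasD i i; field. Qed.

Lemma alucE i : aluc i = (-1) ^+ i * (5 * F i ^+ 2 + L i ^+ 2) / 2.
Proof. by rewrite /aluc mul2n -addnn; have [_ ->] := fib_lucasD i i; field. Qed.

(** The unit source at vertex 0 forces the coefficient 1/5 of [afib]; [aluc] is balanced at vertices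
    0 and 1 without a source, so [q] stays free. *)
Definition osc (q : R) i := afib i / 5 - q * aluc i.

(* Minus the potential at the [i]-th vertex (from 0) of a straight strip entered
   by a unit current at vertex 0; [q] is the free parameter. *)
Definition strip (q : R) i := i%:R / 5 + osc q i.

Lemma oscSS q i : osc q i.+2 = - 3 * osc q i.+1 - osc q i.
Proof.
rewrite /osc; have [-> ->] := afib_alucS i.+1; have [-> ->] := afib_alucS i.
by field.
Qed.

(** Away from the end, three edges of total length 5 cross each cut, so a unit current needs slope
    1/5; [osc] carries no current across such a cut. *)
Lemma strip_harmonic q i :
  (strip q i - strip q i.+1) + (strip q i - strip q i.+2)
  + (0 < i)%N%:R * (strip q i - strip q i.-1)
  + (1 < i)%N%:R * (strip q i - strip q i.-2) = - (i == 0)%N%:R.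
Proof.
rewrite /strip; case: i => [|[|i]] /=.
- rewrite oscSS /osc; have [-> ->] := afib_alucS 0; rewrite afib0 aluc0.
  by field.
- rewrite !oscSS /osc; have [-> ->] := afib_alucS 0; rewrite afib0 aluc0.
  by field.
by rewrite !oscSS -(@natr1 _ i.+2) -(@natr1 _ i.+1) -(@natr1 _ i); field.
Qed.

End FibonacciLucas.

(** * Gluing the two strips at the bend *)

(* Here [K] is [k - 1] and [l.+2] is the [l] of the theorem. *)
Lemma bent_resistance (R : realFieldType) (K l n : nat) (q r : R)
    (u v : 'I_n) :
  (0 < K)%N -> n = (K + l + 4)%N -> u = 0%N :> nat -> v = n.-1 :> nat ->
  osc R r l.+3 = osc R q K - 5^-1 -> osc R r l.+2 = osc R q K.+1 + 5^-1 ->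
  resistance R (@bent_edge n K.+1) u v
  = strip R q K + strip R r l.+2 - strip R q 0 - strip R r 0.
Proof.
move=> K0 nE u0 vn eq3 eq2.
(* Current enters at vertex 0 and leaves at vertex n-1, hence the opposite signs of the two strips;
   [C] makes them agree at index [K]. *)
set C := strip R q K + strip R r l.+2.
pose pot i := if (i <= K.+1)%N then C - strip R q i else strip R r (K + l + 3 - i).
(* Reading from vertex [n-1], the second strip has [K] at position [l+2] and
   [K+1] at position [l+3]. *)
have potl i : (i <= K.+1)%N -> pot i = C - strip R q i by rewrite /pot => ->.
have potr i j : (K.+1 < i)%N -> (i + j = K + l + 3)%N -> pot i = strip R r j.
  by move=> Ki ij; rewrite /pot leqNgt Ki /=; congr strip; lia.
have potK : pot K = strip R r l.+2 by rewrite potl // /C; lra.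
have potK1 : pot K.+1 = strip R r l.+3.
  rewrite potl // /C /strip eq2 eq3 -(@natr1 _ K) -(@natr1 _ l.+2); lra.
(* [bal0] and [bal1] are what the balance at [K+1] and at [K], respectively, demands beyond that of
   the left strip continued straight past the bend. *)
have bal0 : pot K.+1 + strip R r l.+1 = 2 * C - strip R q K.+2 - strip R q K.+3.
  have := oscSS R r l.+1; rewrite potl // /C /strip eq2 eq3 !oscSS.
  rewrite -(@natr1 _ K.+2) -(@natr1 _ K.+1) -(@natr1 _ K) -(@natr1 _ l.+1); lra.
have bal1 : pot K + C - strip R q K.+2 = strip R r l.+1 + strip R r l.
  have := oscSS R r l.+1; have := oscSS R r l.
  rewrite potl // /C /strip eq2 eq3 !oscSS.
  rewrite -(@natr1 _ K.+1) -(@natr1 _ K) -(@natr1 _ l.+1) -(@natr1 _ l); lra.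
have -> : C - strip R q 0 - strip R r 0 = (\col_h pot h) u 0 - (\col_(h < n) pot h) v 0.
  by rewrite !mxE u0 vn potl // (potr n.-1 0%N); lia || lra.
apply: resistance_potential; first exact: bent_edge_sym.
apply/colP => i; rewrite laplacian_bentE; last by lia.
rewrite !mxE -!val_eqE /= u0 vn !andbT.
case: i => i /= iN.
(* For [i < K] all neighbours lie in the left strip, whose balance applies unchanged. *)
have [iK|iK] := ltnP i K.
  have [-> -> -> ->] : [/\ (i.+1 < n)%N = true, (i.+2 < n)%N = true,
    (i == K) = false & (i == K.+3) = false] by split; lia.
  have [-> ->] : (i == K.+1) = false /\ (i == n.-1) = false by split; lia.
  have := strip_harmonic R q i.
  have [le1 le2 le3] : [/\ (i <= K.+1)%N, (i.+1 <= K.+1)%N & (i.+2 <= K.+1)%N].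
    by split; lia.
  have [le4 le5] : (i.-1 <= K.+1)%N /\ (i.-2 <= K.+1)%N by split; lia.
  by rewrite !(potl _ le1, potl _ le2, potl _ le3, potl _ le4, potl _ le5) /=; lra.
have i0 : (0 < i)%N by lia.
have -> : (i == 0)%N = false by lia.
rewrite i0.
have [iK1|iK1] := ltnP K i; last first.
  have iE : i = K by lia.
  rewrite iE in i0 *.
  have [-> -> -> ->] : [/\ (K.+1 < n)%N = true, (K.+2 < n)%N = true,
    (K == K.+1) = false & (K == K.+3) = false] by split; lia.
  have -> : (K == n.-1)%N = false by lia.
  have := strip_harmonic R q K; have -> : (K == 0)%N = false by lia.
  have [le1 le2] : (K.-1 <= K.+1)%N /\ (K.-2 <= K.+1)%N by split; lia.
  have [p2 p3] : pot K.+2 = strip R r l.+1 /\ pot K.+3 = strip R r l.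
    by split; apply: potr; lia.
  move: bal1; rewrite i0 eqxx p2 p3 (potl _ le1) (potl _ le2) (potl K) // (potl K.+1) //=.
  by lra.
have -> : (i == K)%N = false by lia.
have [iK2|iK2] := ltnP K.+1 i; last first.
  have iE : i = K.+1 by lia.
  rewrite iE.
  have [-> -> -> ->] : [/\ (K.+2 < n)%N = true, (K.+3 < n)%N = true,
    (K.+1 == K.+3) = false & (K.+1 == n.-1) = false] by split; lia.
  have := strip_harmonic R q K.+1.
  have [p2 p3] : pot K.+2 = strip R r l.+1 /\ pot K.+3 = strip R r l.
    by split; apply: potr; lia.
  have le1 : (K.-1 <= K.+1)%N by lia.
  by move: bal0; rewrite eqxx p2 p3 /= (potl K.-1) // (potl K) // (potl K.+1) //=; lra.
have [-> i1] : (i == K.+1)%N = false /\ (1 < i)%N = true by split; lia.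
(* Past [K+1] the balance is that of the right strip at position [j]; only [K+2] and [K+3] have
   neighbours across the bend. *)
pose j := (K + l + 3 - i)%N.
have ij : (i + j = K + l + 3)%N by lia.
have [-> ->] : (i.+1 < n)%N = (0 < j)%N /\ (i.+2 < n)%N = (1 < j)%N by split; lia.
have -> : (i == n.-1)%N = (j == 0)%N by lia.
have j1 : (0 < j)%N%:R * pot i.+1 = (0 < j)%N%:R * strip R r j.-1.
  by case: (ltnP 0 j) => jp; rewrite ?mul0r // (potr _ j.-1) //; lia.
have j2 : (1 < j)%N%:R * pot i.+2 = (1 < j)%N%:R * strip R r j.-2.
  by case: (ltnP 1 j) => jp; rewrite ?mul0r // (potr _ j.-2) //; lia.
rewrite i1 !mulrBr j1 j2 (potr i j) //.
have := strip_harmonic R r j; rewrite !mulrBr.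
have [iK3|iK3] := ltnP K.+2 i; last first.
  have iE : i = K.+2 by lia.
  have jE : j = l.+1 by lia.
  have -> : (i == K.+3) = false by lia.
  by rewrite iE jE /= potK potK1; lra.
have [iK4|iK4] := ltnP K.+3 i; last first.
  have iE : i = K.+3 by lia.
  have jE : j = l by lia.
  rewrite iE jE eqxx /= potK potK1 (potr K.+2 l.+1) //; last by lia.
  by lra.
have -> : (i == K.+3) = false by lia.
rewrite (potr i.-1 j.+1) ?(potr i.-2 j.+2) /=; [by lra | by lia..].
Qed.

(** * Solving the matching equations *)

(* With [l] as in the theorem and [K = k-1], to be used with [x, y = F_K, L_K],
   [z, w = F_(l+1), L_(l+1)], [s = (-1)^K] and [t = (-1)^(l+1)]; then [a], [b] are
   [afib], [aluc] at [K], [a1], [b1] at [K+1], [c], [d] at [l+1], [c0], [d0] at [l]. *)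
Lemma matching_solution (R : realFieldType) (x y z w s t : R) :
  s ^+ 2 = 1 -> t ^+ 2 = 1 ->
  y ^+ 2 = 5 * x ^+ 2 + 4 * s -> w ^+ 2 = 5 * z ^+ 2 + 4 * t ->
  0 < x -> 0 < y -> 0 < z -> 0 < w ->
  let a := s * (x * y) in let b := s * (5 * x ^+ 2 + y ^+ 2) / 2 in
  let c := t * (z * w) in let d := t * (5 * z ^+ 2 + w ^+ 2) / 2 in
  let a1 := - (3 * a + b) / 2 in let b1 := - (5 * a + 3 * b) / 2 in
  let c0 := - (3 * c - d) / 2 in let d0 := (5 * c - 3 * d) / 2 in
  exists q r : R,
    [/\ c / 5 - r * d = a / 5 - q * b - 5^-1,
       c0 / 5 - r * d0 = a1 / 5 - q * b1 + 5^-1 &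
       (a + a1 + 1) / 5 - q * (b + b1) + 2 * q + 2 * r =
         (z * w * x ^+ 2 + x * y * ((w - z) / 2) ^+ 2) *
         (z * w * ((y - x) / 2) ^+ 2 + x * y * z ^+ 2 + x * y * (z * w)) /
         (x * y * (z * w) * ((x * w + y * z) * (y * w + 5 * x * z) / 4))
         - (x / y + z / w) / 5 + 5^-1].
Proof.
move=> s1 t1 ys wt x0 y0 z0 w0 a b c d a1 b1 c0 d0.
have sN0 : s != 0 by rewrite -sqrf_eq0 s1 oner_eq0.
have tN0 : t != 0 by rewrite -sqrf_eq0 t1 oner_eq0.
have xN0 := lt0r_neq0 x0; have yN0 := lt0r_neq0 y0.
have zN0 := lt0r_neq0 z0; have wN0 := lt0r_neq0 w0.
have FN0 : x * w + y * z != 0 by rewrite lt0r_neq0 ?addr_gt0 ?mulr_gt0.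
have LN0 : y * w + 5 * x * z != 0 by rewrite lt0r_neq0 ?addr_gt0 ?mulr_gt0.
(* In the intended use this is 2 s t F_(2m+2), the source of that factor in the denominator. *)
have detE : b * c + a * d = s * t * (x * w + y * z) * (y * w + 5 * x * z) / 2.
  by rewrite /a /b /c /d; field.
have detN0 : b * c + a * d != 0.
  by rewrite detE !mulf_neq0 // invr_neq0 // pnatr_eq0.
(* Up to sign, [D] is the determinant of the first two equations in [q] and [r]; the witnesses are
   given by Cramer's rule. *)
pose D := 5 * (b * c + a * d) / 2.
exists (((c0 - a1 - 1) * d - (c - a + 1) * d0) / 5 / D).
exists (- ((c - a + 1) * b1 - (c0 - a1 - 1) * b) / 5 / D).
rewrite /D; split.
- by rewrite /d0 /c0 /b1 /a1; field.
- by rewrite /d0 /c0 /b1 /a1; field.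
rewrite detE /d0 /c0 /b1 /a1 /a /b /c /d; field: s1 t1 ys wt.
by rewrite wN0 yN0 LN0 FN0 zN0 xN0 tN0.
Qed.

(** * Assembling the closed formula *)

Theorem theorem3p2 (R : realFieldType) (n k : nat)
    (hn : (6 <= n)%N) (hk : (2 <= k <= n - 3)%N)
    (u v : 'I_n) (hu : vlabel u = 1%N) (hv : vlabel v = n) :
  let m := (n - 2)%N in
  let l := (m - k + 1)%N in
  let F (p : nat) : R := (fib p)%:R in
  let L (q : nat) : R := (lucas q)%:R in
  resistance R (bent_edge k) u v =
    (F (2 * l + 2)%N * F (k - 1)%N ^+ 2 + F (2 * k - 2)%N * F l ^+ 2)
      * (F (2 * l + 2)%N * F (k - 2)%N ^+ 2 + F (2 * k - 2)%N * F (l + 1)%N ^+ 2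
           + F (2 * k - 2)%N * F (2 * l + 2)%N)
      / (F (2 * k - 2)%N * F (2 * l + 2)%N * F (2 * m + 2)%N)
    + \sum_(1 <= i < (k - 2).+1) F i * F i.+1 / (L i * L i.+1)
    + \sum_(1 <= i < l.+1) F i * F i.+1 / (L i * L i.+1).
Proof.
have [K [l [K0 kE nE]]] : exists K l, [/\ (0 < K)%N, k = K.+1 & n = (K + l + 4)%N].
  by exists k.-1, (n - k - 3)%N; split; lia.
rewrite kE => m l0 F L.
have l0E : l0 = l.+2 by rewrite /l0 /m nE; lia.
have mE : (2 * m + 2 = 2 * (K + l.+3))%N by rewrite /m nE; lia.
have lE : (2 * l0 + 2 = 2 * l.+3)%N by rewrite l0E; lia.
have FDbl p : F (2 * p)%N = F p * L p.
  by rewrite mul2n -addnn /F; have [-> _] := fib_lucasD R p p; rewrite -/(L p); field.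
(* Running the recurrence backwards removes F_(k-2) and F_l, leaving only values at [K] and
   [l.+3]. *)
have FPred p : F p = (L p.+1 - F p.+1) / 2.
  by rewrite /F /L; have [-> ->] := fib_lucasS R p; field.
have FK1 : F K.-1 = (L K - F K) / 2 by rewrite FPred prednK.
have [FD LD] := fib_lucasD R K l.+3.
have sgn p : ((-1) ^+ p) ^+ 2 = 1 :> R by rewrite sqrr_sign.
have [q [r [eq3 eq2 tot]]] := matching_solution _ _ _ _ _ _ _
  (sgn K) (sgn l.+3) (lucas_sqr R K) (lucas_sqr R l.+3)
  (fib_gt0 R K K0) (lucas_gt0 R K) (fib_gt0 R l.+3 isT) (lucas_gt0 R l.+3).
rewrite -!alucE -!afibE in eq3 eq2 tot.
have [aS bS] := afib_alucS R K.
have [cS dS] := afib_alucS R l.+2.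
have c0E : afib R l.+2 = - (3 * afib R l.+3 - aluc R l.+3) / 2.
  by rewrite cS dS; field.
have d0E : aluc R l.+2 = (5 * afib R l.+3 - 3 * aluc R l.+3) / 2.
  by rewrite cS dS; field.
rewrite -c0E -d0E -aS -bS in eq2; rewrite -aS -bS in tot.
rewrite (bent_resistance R K l n q r) //; last first.
- by move: hv; rewrite /vlabel; lia.
- by move: hu; rewrite /vlabel; lia.
(* The values at position 0 contribute 2q + 2r, as on the left of [tot]. *)
rewrite /strip /osc eq2 afib0 aluc0.
rewrite lE mE l0E.
have -> : (K.+1 - 2).+1 = K by lia.
have -> : (K.+1 - 1)%N = K by lia.
have -> : (K.+1 - 2)%N = K.-1 by lia.
have -> : (2 * K.+1 - 2 = 2 * K)%N by lia.
rewrite addn1 !FDbl FK1 (FPred l.+2).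
have -> : F (K + l.+3)%N * L (K + l.+3)%N
    = (F K * L l.+3 + L K * F l.+3) * (L K * L l.+3 + 5 * F K * F l.+3) / 4.
  by rewrite /F /L FD LD; field.
(* The telescoped sums supply the linear terms of both strips and the ratios F/L in [tot]; with the
   large quotient named [X], the rest is linear. *)
rewrite -[X in index_iota 1 X](prednK K0) !sum_fib_lucas prednK //.
have -> : K.-1%:R = K%:R - 1 :> R by rewrite -[in RHS](prednK K0) -natr1 addrK.
move: tot; rewrite -/(F K) -/(L K) -/(F l.+3) -/(L l.+3).
set X := _ / (_ * _).
by lra.
Qed.
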